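(* Let $f:\mathbb{R}^n\to\mathbb{R}$ be twice-differentiable and suppose there are constants $0<\mu\le L$ such that $\mu I\preceq\nabla^2 f(x)\preceq L I$ for all $x\in\mathbb{R}^n$ (i.e. $f$ is $\mu$-strongly convex with $L$-Lipschitz continuous gradient). Let $x_*$ be the minimizer of $f$. Let $x_0\in\mathbb{R}^n$ and let $(x_k)_{k\ge 0}$ satisfy, for every $k\ge 0$, $$x_{k+1}=x_k-\alpha_k\nabla^2 f(x_k)^{-1}\nabla f(x_k),\qquad \alpha_k\in\mathop{\rm arg\,min}_{\alpha\in\mathbb{R}} f\big(x_k-\alpha\nabla^2 f(x_k)^{-1}\nabla f(x_k)\big).$$ Then for every $k\ge 0$, $$f(x_k)-f(x_* )\le\left(1-\frac{\mu^2}{L^2}\right)^k\,[f(x_0)-f(x_* )].$$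
   Context: Here $A\preceq B$ for symmetric matrices means $B-A$ is positive semidefinite, and $I$ is the $n\times n$ identity matrix. The iteration is Newton's method with exact line search (''greedy Newton''). *)

(* Defs.v *)
From mathcomp Require Export all_boot all_order all_algebra.
From mathcomp Require Export all_classical all_reals all_analysis.
Export Order.TTheory GRing.Theory Num.Theory.
Export numFieldNormedType.Exports.

Set Implicit Arguments.
Unset Strict Implicit.
Unset Printing Implicit Defensive.

Local Open Scope classical_set_scope.
Local Open Scope ring_scope.

(* Points of R^n are row vectors 'rV[R]_n.  Differentiability is that of
   Fréchet; the sup norm carried by 'rV[R]_n induces the same notion as the
   Euclidean norm. *)

Definition gradient (R : realType) (n : nat) (f : 'rV[R]_n -> R)
    (x : 'rV[R]_n) : 'rV[R]_n :=
  \row_(j < n) 'D_(delta_mx 0 j) f x.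

Definition twice_differentiable (R : realType) (n : nat)
    (f : 'rV[R]_n -> R) : Prop :=
  (forall x, differentiable f x) /\ (forall x, differentiable (gradient f) x).

(* The library's Jacobian acts on row vectors from the right: the differential
   of the gradient at x maps u to u *m hessian f x, and the (i, j) entry of
   hessian f x is the i-th partial derivative of the j-th one. *)
Definition hessian (R : realType) (n : nat) (f : 'rV[R]_n -> R)
    (x : 'rV[R]_n) : 'M[R]_n :=
  'J (gradient f) x.

(* Symmetry is not part of the definition: the Hessian of a twice
   differentiable function is symmetric by Schwarz's theorem, so it need not
   be assumed. *)
Definition psdmx (R : realType) (n : nat) (A : 'M[R]_n) : Prop :=
  forall v : 'rV[R]_n, 0 <= (v *m A *m v^T) 0 0.

Definition loewner_le (R : realType) (n : nat) (A B : 'M[R]_n) : Prop :=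
  psdmx (B - A).

Definition argmin (R : realType) (T : Type) (g : T -> R) : set T :=
  [set a | forall b, g a <= g b].

(* H^-1 g in row-vector form. *)
Definition newton_direction (R : realType) (n : nat) (f : 'rV[R]_n -> R)
    (x : 'rV[R]_n) : 'rV[R]_n :=
  gradient f x *m invmx (hessian f x).

(* Main.v *)
(* With [H] the Hessian at [x], [g] the gradient and [d] solving [d H = g],
   convexity and smoothness make the gradient cocoercive; differentiating
   this along [d] gives [|g|^2 <= L <g, d>], while [mu |d|^2 <= <g, d>] by
   strong convexity.  The descent lemma with step [mu / L] along [d] then
   decreases [f] by at least [mu / (2 L) <g, d> >= mu / (2 L^2) |g|^2], and
   exact line search does no worse.  Strong convexity also bounds the
   suboptimality by [|g|^2 / (2 mu)], so each step removes at least the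
   fraction [mu^2 / L^2] of it. *)
Require Import Defs.
From mathcomp Require Import ring lra.

Local Open Scope classical_set_scope.
Local Open Scope ring_scope.

(** * The Euclidean inner product on row vectors *)

Section dot_product.
Context {R : realType} {n : nat}.
Implicit Types (u v w : 'rV[R]_n) (a : R).

Definition dotv u v : R := (u *m v^T) 0 0.

Lemma dotvE u v : dotv u v = \sum_j u 0 j * v 0 j.
Proof. by rewrite /dotv mxE; apply: eq_bigr => j _; rewrite mxE. Qed.

Lemma dotvC u v : dotv u v = dotv v u.
Proof. by rewrite !dotvE; apply: eq_bigr => j _; rewrite mulrC. Qed.

Lemma dotvDl u v w : dotv (u + v) w = dotv u w + dotv v w.
Proof. by rewrite /dotv mulmxDl mxE. Qed.

Lemma dotvZl a u v : dotv (a *: u) v = a * dotv u v.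
Proof. by rewrite /dotv -scalemxAl mxE. Qed.

Lemma dotvNl u v : dotv (- u) v = - dotv u v.
Proof. by rewrite -scaleN1r dotvZl mulN1r. Qed.

Lemma dotvBl u v w : dotv (u - v) w = dotv u w - dotv v w.
Proof. by rewrite dotvDl dotvNl. Qed.

Lemma dotvDr u v w : dotv u (v + w) = dotv u v + dotv u w.
Proof. by rewrite dotvC dotvDl !(dotvC u). Qed.

Lemma dotvZr a u v : dotv u (a *: v) = a * dotv u v.
Proof. by rewrite dotvC dotvZl dotvC. Qed.

Lemma dotvNr u v : dotv u (- v) = - dotv u v.
Proof. by rewrite dotvC dotvNl dotvC. Qed.

Lemma dotvBr u v w : dotv u (v - w) = dotv u v - dotv u w.
Proof. by rewrite dotvDr dotvNr. Qed.

Lemma dotvv_ge0 u : 0 <= dotv u u.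
Proof. by rewrite dotvE sumr_ge0 // => j _; rewrite -expr2 sqr_ge0. Qed.

Lemma dotvv_eq0 u : dotv u u = 0 -> u = 0.
Proof.
rewrite dotvE => /eqP; rewrite psumr_eq0; last first.
  by move=> j _; rewrite -expr2 sqr_ge0.
move=> /allP u0; apply/rowP => j; rewrite mxE.
by have := u0 j (mem_index_enum j); rewrite /= mulf_eq0 orbb => /eqP.
Qed.

(** Used to pass to the limit inside inner products of difference quotients. *)
Lemma cvg_dotv {T : Type} {F : set_system T} {FF : Filter F}
    {U V : T -> 'rV[R]_n} {u v} :
  U @ F --> u -> V @ F --> v -> dotv (U t) (V t) @[t --> F] --> dotv u v.
Proof.
move=> Uu Vv.
have cvg_coord (Z : T -> 'rV[R]_n) (z : 'rV[R]_n) j :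
    Z @ F --> z -> Z t 0 j @[t --> F] --> z 0 j.
  by move=> Zz; exact: (cvg_comp Z _ Zz (@coord_continuous R 1 n 0 j z)).
under eq_cvg do rewrite dotvE.
rewrite dotvE; apply: (cvg_big (op := +%R) (x0 := 0 : R)) => [|j _].
  exact: add_continuous.
by apply: cvgM; exact: cvg_coord.
Qed.

End dot_product.

(** * Taylor lower bound in one variable *)

Section real_line.
Context {R : realType}.

Lemma ge0_is_derive_ge {g dg : R -> R} :
  (forall t : R, is_derive t 1 g (dg t)) -> (forall t, 0 <= t -> 0 <= dg t) ->
  forall t, 0 <= t -> g 0 <= g t.
Proof.
move=> gdg dg0 t t0.
have [|c c0t gE] := @MVT_segment R g dg 0 t t0 (fun c _ => gdg c).
  apply: derivable_within_continuous => z _; exact: ex_derive.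
rewrite -subr_ge0 gE subr0 mulr_ge0 //; apply: dg0.
by move: c0t; rewrite in_itv /= => /andP[].
Qed.

(** Monotonicity used twice replaces integration, as [ddg] is not known to be integrable:
    [dg t - m t], then [g t - dg 0 t - m t^2 / 2], has nonnegative derivative for [t >= 0]. *)
Lemma second_order_lower_bound {g dg ddg : R -> R} {m : R} :
  (forall t : R, is_derive t 1 g (dg t)) -> (forall t : R, is_derive t 1 dg (ddg t)) ->
  (forall t, m <= ddg t) -> g 0 + dg 0 + m / 2 <= g 1.
Proof.
move=> gdg dgddg mddg.
have id1 (t : R) : is_derive t (1 : R) (@id R) 1 by exact: is_derive_id.
have dg_ge t : 0 <= t -> dg 0 + m * t <= dg t.
  move=> t0; pose h := dg - m *: (@id R).
  have hdh (s : R) : is_derive s 1 h (ddg s - m *: 1) by apply: is_deriveB.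
  have := ge0_is_derive_ge hdh _ _ t0.
  rewrite /h !fctE /GRing.scale /= mulr0 subr0 => H.
  rewrite -lerBrDr; apply: H => s _; rewrite mulr1 subr_ge0; exact: mddg.
pose h := g - dg 0 *: (@id R) - (m / 2) *: ((@id R) ^+ 2).
have hdh (s : R) : is_derive s 1 h (dg s - dg 0 - m * s).
  by apply: is_derive_eq; rewrite /GRing.scale /= expr1 mulr1; field.
have := ge0_is_derive_ge hdh _ _ ler01.
rewrite /h !fctE /GRing.scale /= => H.
have : forall t, 0 <= t -> 0 <= dg t - dg 0 - m * t.
  by move=> t /dg_ge; lra.
move=> /H; lra.
Qed.

End real_line.

(** * Differentiation along a line *)

Section line_restriction.
Context {R : realType} {V W : normedModType R}.

Lemma is_derive_line {g : V -> W} {x v : V} {t : R} :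
  differentiable g (x + t *: v) ->
  is_derive t 1 (fun s => g (x + s *: v)) ('D_v g (x + t *: v)).
Proof.
move=> dg.
have E : (fun h : R => h^-1 *:
      (((fun s => g (x + s *: v)) \o shift t) (h *: 1) - g (x + t *: v))) =
    (fun h : R => h^-1 *: ((g \o shift (x + t *: v)) (h *: v) - g (x + t *: v))).
  apply/funext => h /=; do 3! congr (_ _).
  by rewrite [h%:A]mulr1 scalerDl addrCA addrA.
by split; rewrite /derivable /derive E //; exact: diff_derivable.
Qed.

End line_restriction.

(** * Quadratic bounds from bounds on the Hessian *)

Section quadratic_bounds.
Context {R : realType} {n : nat}.
Context {f : 'rV[R]_n -> R} (f_diff2 : twice_differentiable f).
Implicit Types x y v : 'rV[R]_n.

Lemma derive_gradient x v : 'D_v f x = dotv (gradient f x) v.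
Proof.
have [f1 _] := f_diff2; rewrite deriveE // dotvE {1}(row_sum_delta v) linear_sum.
by apply: eq_bigr => j _; rewrite linearZ /= -deriveE // !mxE mulrC.
Qed.

Lemma derive_gradient_hessian x v : 'D_v (gradient f) x = v *m hessian f x.
Proof. by rewrite deriveEjacobian //; exact: (f_diff2.2 x). Qed.

Lemma is_derive_gradient_line x v (t : R) :
  is_derive t 1 (fun s => dotv (gradient f (x + s *: v)) v)
    (dotv (v *m hessian f (x + t *: v)) v).
Proof.
have [gcvg gE] := is_derive_line (f_diff2.2 (x + t *: v)).
rewrite derive_gradient_hessian in gE.
have {}gcvg : h^-1 *: (((fun s => gradient f (x + s *: v)) \o shift t) (h *: 1) -
    gradient f (x + t *: v)) @[h --> (0 : R)^'] --> v *m hessian f (x + t *: v).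
  by rewrite -gE; exact: gcvg.
have dcvg := cvg_dotv gcvg (cvg_cst v).
have E : (fun h : R => dotv (h^-1 *: (((fun s => gradient f (x + s *: v)) \o
      shift t) (h *: 1) - gradient f (x + t *: v))) v) =
    (fun h : R => h^-1 *: (((fun s => dotv (gradient f (x + s *: v)) v) \o
      shift t) (h *: 1) - dotv (gradient f (x + t *: v)) v)).
  by apply/funext => h /=; rewrite dotvZl dotvBl.
by split; [apply/cvg_ex; eexists|apply: cvg_lim => //]; rewrite -E; exact: dcvg.
Qed.

(** Taylor bound along the segment from [x] to [y], where the second derivative of [f] is at least
    [m |y - x|^2]. *)
Lemma lower_quadratic_bound {m : R} x y :
  (forall z, loewner_le m%:M (hessian f z)) ->
  f x + dotv (gradient f x) (y - x) + m / 2 * dotv (y - x) (y - x) <= f y.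
Proof.
move=> mH; set v := y - x.
have fl (t : R) : is_derive t 1 (fun s => f (x + s *: v))
    (dotv (gradient f (x + t *: v)) v).
  by rewrite -derive_gradient; apply: is_derive_line; exact: f_diff2.1.
have mv t : m * dotv v v <= dotv (v *m hessian f (x + t *: v)) v.
  have := mH (x + t *: v) v.
  by rewrite -/(dotv _ _) mulmxBr dotvBl mul_mx_scalar dotvZl subr_ge0.
have := second_order_lower_bound fl (is_derive_gradient_line x v) mv.
by rewrite scale0r addr0 scale1r subrKC mulrAC.
Qed.

(** The one-variable lower bound, applied to [- f] along the segment. *)
Lemma upper_quadratic_bound {M : R} x y :
  (forall z, loewner_le (hessian f z) M%:M) ->
  f y <= f x + dotv (gradient f x) (y - x) + M / 2 * dotv (y - x) (y - x).
Proof.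
move=> HM; set v := y - x.
have fl (t : R) : is_derive t 1 (- (fun s => f (x + s *: v)))
    (- dotv (gradient f (x + t *: v)) v).
  apply: is_deriveN; rewrite -derive_gradient.
  by apply: is_derive_line; exact: f_diff2.1.
have mv t : - (M * dotv v v) <= - dotv (v *m hessian f (x + t *: v)) v.
  rewrite lerN2; have := HM (x + t *: v) v.
  by rewrite -/(dotv _ _) mulmxBr dotvBl mul_mx_scalar dotvZl subr_ge0.
have := second_order_lower_bound fl
  (fun t => is_deriveN (is_derive_gradient_line x v t)) mv.
rewrite !fctE scale0r addr0 scale1r subrKC; lra.
Qed.

(** * Cocoercivity of the gradient and of the Hessian *)

Section convex.
Context {L : R} (L_gt0 : 0 < L).
Context (hess_psd : forall z, psdmx (hessian f z)).
Context (hess_le : forall z, loewner_le (hessian f z) L%:M).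

(* Descent lemma for [f - dotv (gradient f x)], which is minimal at [x], from
   [y] with step [1 / L]. *)
Lemma bregman_gradient_bound x y :
  dotv (gradient f y - gradient f x) (gradient f y - gradient f x) / (2 * L) <=
  f y - f x - dotv (gradient f x) (y - x).
Proof.
set w := gradient f y - gradient f x; pose z := y - L^-1 *: w.
(* Convexity, as the lower quadratic bound with modulus 0. *)
have lo : f x + dotv (gradient f x) (z - x) <= f z.
  have := @lower_quadratic_bound 0 x z; rewrite !mul0r addr0; apply=> u.
  by rewrite /loewner_le raddf0 subr0.
have up := upper_quadratic_bound y z hess_le.
have ww : dotv w w = dotv (gradient f y) w - dotv (gradient f x) w.
  by rewrite -dotvBl.
have zx : z - x = (y - x) - L^-1 *: w by rewrite /z addrAC.
have zy : z - y = - (L^-1 *: w) by rewrite /z addrAC subrr add0r.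
move: lo up ww; rewrite {}zx {}zy; move: (f z) => fz; move: w {z} => w.
rewrite !(dotvBr, dotvNr, dotvNl, dotvZr, dotvZl) opprK => lo up ww.
(* The quadratic term costs half of the first-order gain [|w|^2 / L]. *)
have -> : dotv w w / (2 * L) = L^-1 * dotv w w - L / 2 * (L^-1 * (L^-1 * dotv w w)).
  by field; rewrite gt_eqF.
rewrite {1}ww mulrBr; lra.
Qed.

(** Adding the previous bound to its copy with [x] and [y] exchanged cancels the values of [f]. *)
Lemma gradient_cocoercive x y :
  dotv (gradient f y - gradient f x) (gradient f y - gradient f x) <=
  L * dotv (gradient f y - gradient f x) (y - x).
Proof.
have := lerD (bregman_gradient_bound x y) (bregman_gradient_bound y x).
rewrite -(opprB (gradient f y)) -(opprB y x) dotvNl !dotvNr opprK.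
set q := dotv (_ - _) (_ - _).
have -> : q / (2 * L) + q / (2 * L) = L^-1 * q by field; rewrite gt_eqF.
by rewrite ler_pdivrMl // => /le_trans; apply; rewrite dotvBl ler_pM2l //; lra.
Qed.

(* For a symmetric matrix this would follow from [0 <= H <= L]; differentiating
   the cocoercivity of the gradient avoids proving the Hessian symmetric. *)
Lemma hessian_cocoercive x v :
  dotv (v *m hessian f x) (v *m hessian f x) <= L * dotv (v *m hessian f x) v.
Proof.
have gcvg : derivable (gradient f) x v by apply: diff_derivable; exact: f_diff2.2.
have {}gcvg : h^-1 *: ((gradient f \o shift x) (h *: v) - gradient f x)
    @[h --> (0 : R)^'] --> v *m hessian f x.
  by rewrite -derive_gradient_hessian; exact: gcvg.
have lcvg := cvg_dotv gcvg gcvg.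
have rcvg := cvgM (cvg_cst L) (cvg_dotv gcvg (cvg_cst v)).
(* It remains to compare the difference quotients: this is cocoercivity between [x] and [x + h v],
   divided by [h^2]. *)
apply: (ler_cvg_to (lcvg _) (rcvg _ _ _ _)).
near=> h; rewrite /= !(dotvZl, dotvZr).
have h0 : h != 0 by near: h; exact: nbhs_dnbhs_neq.
have := gradient_cocoercive x (h *: v + x); rewrite addrK dotvZr => gh.
have := ler_wpM2l (sqr_ge0 h^-1) gh; set p := dotv _ v; set q := dotv _ _.
have -> : h^-1 ^+ 2 * (L * (h * p)) = L * (h^-1 * p) by field.
by rewrite expr2 -mulrA.
Unshelve. all: by end_near. Qed.

End convex.

(** The Polyak-Lojasiewicz inequality: the lower quadratic bound is minimized over [v = y - x] by
    completing the square [|gradient f x + m v|^2]. *)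
Lemma gradient_dominated {m : R} x y : 0 < m ->
  (forall z, loewner_le m%:M (hessian f z)) ->
  f x - f y <= dotv (gradient f x) (gradient f x) / (2 * m).
Proof.
move=> m0 /(lower_quadratic_bound x y); move: (y - x) => v fxy.
have := dotvv_ge0 (gradient f x + m *: v).
rewrite !(dotvDl, dotvDr, dotvZl, dotvZr) (dotvC v) => sq.
rewrite ler_pdivlMr ?mulr_gt0 //.
have := ler_wpM2l (mulr_ge0 (ler0n R 2) (ltW m0)) fxy; lra.
Qed.

End quadratic_bounds.

(** If [u H = 0], then [m |u|^2 <= <u H, u> = 0], so the left kernel is trivial. *)
Lemma strongly_positive_unitmx {R : realType} {n : nat} {m : R} {H : 'M[R]_n} :
  0 < m -> loewner_le m%:M H -> H \in unitmx.
Proof.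
move=> m0 mH; rewrite -row_free_unit -kermx_eq0; apply/eqP/row_matrixP => i.
rewrite row0; set u := row i _.
have uH : u *m H = 0 by rewrite -row_mul mulmx_ker row0.
apply: dotvv_eq0; apply/eqP; rewrite eq_le dotvv_ge0 andbT.
have := mH u; rewrite -/(dotv _ _) mulmxBr uH sub0r mul_mx_scalar dotvNl dotvZl.
by rewrite oppr_ge0 pmulr_rle0.
Qed.

(** * Decrease in one Newton step *)

Section newton.
Context {R : realType} {n : nat} {f : 'rV[R]_n -> R} {mu L : R}.
Context (mu_gt0 : 0 < mu) (le_mu_L : mu <= L).
Context (f_diff2 : twice_differentiable f).
Context (hess_ge : forall z, loewner_le mu%:M (hessian f z)).
Context (hess_le : forall z, loewner_le (hessian f z) L%:M).

Lemma strongly_convex_psd x : psdmx (hessian f x).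
Proof.
move=> v; have := hess_ge x v.
rewrite -!/(dotv _ _) mulmxBr dotvBl mul_mx_scalar dotvZl subr_ge0.
by apply: le_trans; rewrite mulr_ge0 ?dotvv_ge0 // ltW.
Qed.

(* The step [mu / L] is not optimal, but already gives the rate. *)
Lemma newton_step_decrease x y :
  f (x - (mu / L) *: newton_direction f x) - f y <=
  (1 - mu ^+ 2 / L ^+ 2) * (f x - f y).
Proof.
have L_gt0 : 0 < L by exact: lt_le_trans le_mu_L.
set g := gradient f x; set d := newton_direction f x.
have dH : d *m hessian f x = g.
  rewrite /d /newton_direction mulmxKV //.
  exact: strongly_positive_unitmx mu_gt0 (hess_ge x).
have gg : dotv g g <= L * dotv g d.
  rewrite -dH; apply: hessian_cocoercive => //; exact: strongly_convex_psd.
have dd : mu * dotv d d <= dotv g d.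
  have := hess_ge x d.
  by rewrite -/(dotv _ _) mulmxBr dH dotvBl mul_mx_scalar dotvZl subr_ge0.
have up := upper_quadratic_bound f_diff2 x (x - (mu / L) *: d) hess_le.
have pl := gradient_dominated f_diff2 x y mu_gt0 hess_ge.
rewrite (addrAC x) subrr add0r -/g in up pl.
rewrite !(dotvNr, dotvNl, dotvZr, dotvZl) in up.
have L0 : L != 0 by rewrite gt_eqF.
have mu0 : mu != 0 by rewrite gt_eqF.
(* The quadratic term costs at most half of the first-order gain [(mu / L) <g, d>]. *)
have h1 : L / 2 * (mu / L * (mu / L * dotv d d)) <= mu / L / 2 * dotv g d.
  have := ler_wpM2l (_ : 0 <= mu / L / 2) dd.
  have -> : mu / L / 2 * (mu * dotv d d) = L / 2 * (mu / L * (mu / L * dotv d d)).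
    by field.
  by apply; rewrite !divr_ge0 // ltW.
(* The other half covers the claimed fraction of the gap, by gradient domination and then [gg]. *)
have h2 : mu ^+ 2 / L ^+ 2 * (f x - f y) <= mu / L / 2 * dotv g d.
  have c0 : 0 <= mu ^+ 2 / L ^+ 2 by rewrite divr_ge0 ?sqr_ge0.
  apply: le_trans (ler_wpM2l c0 pl) _.
  have -> : mu ^+ 2 / L ^+ 2 * (dotv g g / (2 * mu)) =
    mu / L / 2 * (L^-1 * dotv g g) by field; rewrite L0 mu0.
  by apply: ler_wpM2l; [rewrite !divr_ge0 // ltW|rewrite ler_pdivrMl].
lra.
Qed.

End newton.

Theorem proposition1 (R : realType) (n : nat) (f : 'rV[R]_n -> R) (mu L : R)
  (mu_gt0 : 0 < mu) (le_mu_L : mu <= L)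
  (f_diff2 : twice_differentiable f)
  (hess_bounds : forall x : 'rV[R]_n,
     loewner_le mu%:M (hessian f x) /\ loewner_le (hessian f x) L%:M)
  (xstar : 'rV[R]_n) (xstar_min : argmin f xstar)
  (x : nat -> 'rV[R]_n) (alpha : nat -> R)
  (newton_step : forall k : nat,
     x k.+1 = x k - alpha k *: newton_direction f (x k))
  (exact_line_search : forall k : nat,
     argmin (fun a : R => f (x k - a *: newton_direction f (x k))) (alpha k)) :
  forall k : nat,
    f (x k) - f xstar <= (1 - mu ^+ 2 / L ^+ 2) ^+ k * (f (x 0%N) - f xstar).
Proof.
have [hess_ge hess_le] := all_and2 hess_bounds.
have rate_ge0 : 0 <= 1 - mu ^+ 2 / L ^+ 2.
  have L_gt0 : 0 < L by exact: lt_le_trans le_mu_L.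
  rewrite subr_ge0 ler_pdivrMr ?exprn_gt0 // mul1r.
  by rewrite lerXn2r // nnegrE ltW.
elim=> [|k IHk]; first by rewrite expr0 mul1r.
rewrite exprS -mulrA; apply: le_trans (ler_wpM2l rate_ge0 IHk).
apply: le_trans (newton_step_decrease mu_gt0 le_mu_L f_diff2 hess_ge hess_le _ _).
(* The step [alpha k] is at least as good as the step [mu / L]. *)
by rewrite lerD2r newton_step; exact: exact_line_search.
Qed.
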